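(* Let $M=(E,\Delta)$ be a matroid of rank $r$ that is realizable over some field, and let $(f_0,f_1,\ldots,f_r)$ be the $f$-vector of its matroid complex $\Delta$. Then the $f$-vector is strictly log-concave, i.e. $$f_i^2 > f_{i-1}f_{i+1}\qquad\text{for } i=1,\ldots,r-1.$$
   Context: A matroid $M=(E,\Delta)$ has finite ground set $E$ and matroid complex $\Delta\subseteq 2^E$, the simplicial complex of independent sets. The rank $r$ of $M$ is the maximal cardinality of an independent set. The $f$-vector $(f_0,\ldots,f_r)$ is defined by $f_i=\#\{A\in\Delta : |A|=i\}$. A matroid is realizable over a field $\mathbb{K}$ if there is a list of vectors in some $\mathbb{K}^n$, indexed by $E$, whose linearly independent sublists are exactly the sets in $\Delta$. *)

(* Defs.v *)
From HB Require Import structures.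
From mathcomp Require Import all_boot all_order all_algebra.
Set Implicit Arguments. Unset Strict Implicit. Unset Printing Implicit Defensive.
Import GRing.Theory.

Definition is_matroid_complex (E : finType) (D : {set {set E}}) : Prop :=
  [/\ set0 \in D,
      (forall A B : {set E}, B \in D -> A \subset B -> A \in D) &
      (forall A B : {set E}, A \in D -> B \in D -> #|A| < #|B| ->
         exists2 e, e \in B :\: A & e |: A \in D)].

Definition indep_sets (K : fieldType) (n : nat) (E : finType)
  (v : E -> 'rV[K]_n) : {set {set E}} :=
  [set A : {set E} | free (map v (enum A))].

Definition realizable (E : finType) (D : {set {set E}}) : Prop :=
  exists (K : fieldType) (n : nat) (v : E -> 'rV[K]_n), D = indep_sets v.

Definition mrank (E : finType) (D : {set {set E}}) : nat :=
  \max_(A in D) #|A|.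

Definition fvec (E : finType) (D : {set {set E}}) (i : nat) : nat :=
  #|[set A in D | #|A| == i]|.

(* Main.v *)
Require Import Defs.
From HB Require Import structures.
From mathcomp Require Import all_boot all_order all_algebra.
From mathcomp Require Import ring lra zify.
Set Implicit Arguments. Unset Strict Implicit. Unset Printing Implicit Defensive.
Import Order.TTheory GRing.Theory Num.Theory.

(** For an arbitrary matroid, consider the quadratic form in (t, x)
      Q_m(t, x) = a t^2 + 2 t (b.x) + x A x,
    where a, b_e and A_ef (e <> f) count the independent sets of size m, of
    size m+1 containing e, and of size m+2 containing e and f.  It is
    hyperbolic: Q_m <= 0 on the Q_m-orthogonal complement of w = (0, 1, ..., 1).
    Comparing (1, 0, ..., 0) with w then gives Mason's inequality
    (m+1) f_(m+1)^2 >= (m+2) f_m f_(m+2), which implies strict log-concavity.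
    Hyperbolicity goes by induction on m.  The forms of the links D/e sum to a
    multiple of Q_(m+1), and the reversed Cauchy-Schwarz inequalities for them
    give a bound of Q_(m+1) by sum_e (t b + A x)_e^2 / (A 1)_e; together with
    connectedness of the graph of A on the non-loops this bound forces
    hyperbolicity.  For m = 0, Q_0 is the square of a linear form minus the sum,
    over the parallel classes, of the squared class sums of x. *)

(** * Hyperbolic quadratic forms and weighted Laplacians *)

Section Forms.
Local Open Scope ring_scope.
Variables (F : realFieldType) (T : finType).
Implicit Types (a t c d : F) (b x y z u : T -> F) (A N : T -> T -> F).

(** Fredholm alternative: [u] lies in the row space once it annihilates the kernel, which the
    columns of [cokermx] span; symmetry turns rows into columns. *)
Lemma solve_symmetric N u :
  (forall e f, N e f = N f e) ->
  (forall v, (forall e, \sum_f N e f * v f = 0) -> \sum_e u e * v e = 0) ->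
  exists z, forall e, \sum_f N e f * z f = u e.
Proof.
move=> symN ortho.
pose NM : 'M[F]_#|T| := \matrix_(i, j) N (enum_val i) (enum_val j).
pose uM : 'rV[F]_#|T| := \row_i u (enum_val i).
have sumE (g : T -> F) : \sum_e g e = \sum_(i < #|T|) g (enum_val i).
  by rewrite (reindex (@enum_val T T)) //; apply: onW_bij; exact: enum_val_bij.
have /submxP[w wE] : (uM <= NM)%MS.
  rewrite submxE; apply/eqP/matrixP=> i j; rewrite !mxE.
  pose v e := cokermx NM (enum_rank e) j.
  rewrite -[RHS](ortho v) ?sumE.
    by apply: eq_bigr => k _; rewrite /v enum_valK mxE.
  move=> e.
  have : (NM *m cokermx NM) (enum_rank e) j = 0 by rewrite mulmx_coker mxE.
  rewrite mxE => NMv; rewrite sumE -[RHS]NMv; apply: eq_bigr => k _.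
  by rewrite [NM _ _]mxE /v enum_valK enum_rankK.
exists (fun e => w 0 (enum_rank e)) => e.
have /matrixP/(_ 0 (enum_rank e)) := wE.
rewrite !mxE enum_rankK => ->; rewrite sumE; apply: eq_bigr => k _.
by rewrite !mxE enum_valK enum_rankK symN mulrC.
Qed.

Definition qform a b A t x :=
  a * t ^+ 2 + 2 * t * (\sum_e b e * x e) + \sum_e \sum_f x e * A e f * x f.

(* The polarization of [qform] evaluated at (t, x) and w = (0, 1, ..., 1). *)
Definition pairing b A t x := t * (\sum_e b e) + \sum_e x e * \sum_f A e f.

Definition hyperbolic a b A :=
  forall t x, pairing b A t x = 0 -> qform a b A t x <= 0.

Lemma qform_affine a b A t x c d : (forall e f, A e f = A f e) ->
  qform a b A (c * t) (fun e => c * x e + d) =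
  c ^+ 2 * qform a b A t x + 2 * c * d * pairing b A t x
  + d ^+ 2 * \sum_e \sum_f A e f.
Proof.
move=> symA; rewrite /qform /pairing.
have -> : \sum_e b e * (c * x e + d) = c * (\sum_e b e * x e) + d * \sum_e b e.
  by rewrite !mulr_sumr -big_split; apply: eq_bigr => e _ /=; ring.
  have cross : \sum_e x e * (\sum_f A e f) = \sum_e \sum_f x f * A e f.
    rewrite exchange_big; apply: eq_bigr => f _; rewrite mulr_sumr.
    by apply: eq_bigr => e _; rewrite symA.
  have -> : \sum_e \sum_f (c * x e + d) * A e f * (c * x f + d) =
      c ^+ 2 * (\sum_e \sum_f x e * A e f * x f)
      + c * d * (\sum_e x e * \sum_f A e f)
      + c * d * (\sum_e \sum_f x f * A e f) + d ^+ 2 * \sum_e \sum_f A e f.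
    rewrite !mulr_sumr -!big_split; apply: eq_bigr => e _ /=.
    by rewrite !mulr_sumr -!big_split; apply: eq_bigr => f _ /=; ring.
  by rewrite -cross; ring.
Qed.

Lemma pairing_affine b A t x c d :
  pairing b A (c * t) (fun e => c * x e + d) =
  c * pairing b A t x + d * \sum_e \sum_f A e f.
Proof.
rewrite /pairing mulrDr mulrA -addrA; congr (_ + _).
by rewrite !mulr_sumr -big_split; apply: eq_bigr => e _ /=; ring.
Qed.

(** The projection of (t, x) off w, scaled by W = Q(w) to avoid division, is orthogonal to w. With q
    = Q(t, x) and p the pairing, Q takes the value W (W q - p^2) there. *)
Lemma hyperbolic_cauchy_schwarz a b A t x :
  (forall e f, A e f = A f e) -> 0 < \sum_e \sum_f A e f ->
  hyperbolic a b A ->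
  qform a b A t x * (\sum_e \sum_f A e f) <= pairing b A t x ^+ 2.
Proof.
move=> symA W0 hyp; set W := \sum_e _ in W0 *.
have := hyp (W * t) (fun e => W * x e + - pairing b A t x).
rewrite pairing_affine qform_affine // -/W mulrC mulNr subrr => /(_ erefl).
set q := qform _ _ _ _ _; set p := pairing _ _ _ _ => le0.
have : W * (q * W - p ^+ 2) <= 0.
  by apply: le_trans le0; rewrite le_eqVlt; apply/orP; left; apply/eqP; ring.
by rewrite pmulr_rle0 // subr_le0.
Qed.

(** The bound makes Q nonpositive on the kernel of [l], and l(w)^2 >= Q(w) > 0. For u orthogonal to
    w, the vector l(w) u - l(u) w is in that kernel and has Q-value l(w)^2 Q(u) + l(u)^2 Q(w), so
    Q(u) <= 0. *)
Lemma hyperbolic_of_rank_one_bound a b A (l : F -> (T -> F) -> F) :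
  (forall e f, A e f = A f e) -> 0 < \sum_e \sum_f A e f ->
  (forall t x c d,
     l (c * t) (fun e => c * x e + d) = c * l t x + d * l 0 (fun=> 1)) ->
  (forall t x, qform a b A t x <= l t x ^+ 2) -> hyperbolic a b A.
Proof.
move=> symA W0 linl bnd t x p0; set W := \sum_e _ in W0.
have qW : qform a b A 0 (fun=> 1) = W.
  rewrite /qform expr2 !(mulr0, mul0r) !add0r; apply: eq_bigr => e _.
  by apply: eq_bigr => f _; rewrite mulr1 mul1r.
have l1 : 0 < l 0 (fun=> 1) ^+ 2 by apply: lt_le_trans (bnd _ _); rewrite qW.
have := bnd (l 0 (fun=> 1) * t) (fun e => l 0 (fun=> 1) * x e + - l t x).
rewrite qform_affine // linl p0 mulr0 addr0 -/W.
have -> : l 0 (fun=> 1) * l t x + - l t x * l 0 (fun=> 1) = 0 by ring.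
rewrite expr0n /= sqrrN => le0.
have := le_trans _ le0; move/(_ (l 0 (fun=> 1) ^+ 2 * qform a b A t x)).
rewrite lerDl mulr_ge0 ?sqr_ge0 ?(ltW W0) // => /(_ isT).
by rewrite pmulr_rle0.
Qed.

(* With N = D - A the Laplacian of A (D = diag deg), solve N z = t b + D x and
   apply the hypothesis to (t, z): it reads a t^2 + z N z <= x D x, while
   Q(t, x) = a t^2 + 2 x N z - x N x - x D x and 2 x N z <= x N x + z N z.
   Loops have deg e = 0, where the summand divided by deg e is 0. *)
Lemma hyperbolic_step a b A (deg := fun e => \sum_f A e f) :
  (forall e f, A e f = A f e) -> (forall e f, 0 <= A e f) ->
  (forall e, deg e = 0 -> b e = 0) ->
  (forall x, (forall e f, 0 < A e f -> x e = x f) ->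
     forall e f, deg e != 0 -> deg f != 0 -> x e = x f) ->
  (forall t x, qform a b A t x <=
     \sum_e (t * b e + \sum_f A e f * x f) ^+ 2 / deg e) ->
  hyperbolic a b A.
Proof.
move=> symA A0 b0 conn bnd t x p0.
pose N e f := (if e == f then deg e else 0) - A e f.
have NE y e : \sum_f N e f * y f = deg e * y e - \sum_f A e f * y f.
  under eq_bigr do rewrite mulrBl.
  rewrite sumrB (bigD1 e) //= eqxx big1 ?addr0 // => f /negPf.
  by rewrite eq_sym => ->; rewrite mul0r.
(* Dirichlet energy of the weighted graph [A]: it vanishes only on vectors constant along edges of
   positive weight. *)
have lapE y : \sum_e y e * (\sum_f N e f * y f) =
    2^-1 * \sum_e \sum_f A e f * (y e - y f) ^+ 2.
  have E1 : \sum_e \sum_f A e f * (y e) ^+ 2 = \sum_e deg e * y e ^+ 2.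
    by apply: eq_bigr => e _; rewrite mulr_suml.
  have E2 : \sum_e \sum_f A e f * (y f) ^+ 2 = \sum_e deg e * y e ^+ 2.
    rewrite exchange_big -E1; apply: eq_bigr => f _.
    by apply: eq_bigr => e _; rewrite symA.
  have -> : \sum_e \sum_f A e f * (y e - y f) ^+ 2 =
     \sum_e \sum_f A e f * (y e) ^+ 2 + \sum_e \sum_f A e f * (y f) ^+ 2
     + (- 2) * \sum_e \sum_f y e * A e f * y f.
    rewrite mulr_sumr -!big_split; apply: eq_bigr => e _ /=.
    by rewrite mulr_sumr -!big_split; apply: eq_bigr => f _ /=; ring.
  rewrite E1 E2.
  have -> : \sum_e y e * (\sum_f N e f * y f) =
     \sum_e deg e * y e ^+ 2 - \sum_e \sum_f y e * A e f * y f.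
    rewrite -sumrB; apply: eq_bigr => e _.
    rewrite NE mulrBr mulr_sumr; congr (_ - _); first ring.
    by apply: eq_bigr => f _; ring.
  by field.
have lap_ge0 y : 0 <= \sum_e y e * (\sum_f N e f * y f).
  rewrite lapE mulr_ge0 ?invr_ge0 // sumr_ge0 // => e _.
  by rewrite sumr_ge0 // => f _; rewrite mulr_ge0 ?sqr_ge0.
(* Solvability: kernel vectors of [N] have zero energy, so by [conn] they are constant where [deg]
   is nonzero; the right-hand side vanishes where [deg] does and sums to the pairing, which is 0. *)
have [z zE] : exists z, forall e, \sum_f N e f * z f = t * b e + deg e * x e.
  apply: solve_symmetric => [e f|v v0].
    by rewrite /N symA eq_sym; case: eqP => [->|].
  have vconst : forall e f, 0 < A e f -> v e = v f.
    move=> e f Aef; apply/eqP; rewrite -subr_eq0 -sqrf_eq0.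
    have := lapE v; rewrite big1 => [|g _]; last by rewrite v0 mulr0.
    move/esym/eqP; rewrite mulf_eq0 invr_eq0 pnatr_eq0 /=.
    have pos g h : 0 <= A g h * (v g - v h) ^+ 2 by rewrite mulr_ge0 ?sqr_ge0.
    rewrite psumr_eq0 => [|g _]; last exact: sumr_ge0.
    move/allP/(_ e (mem_index_enum _)) => /=; rewrite psumr_eq0 //.
    move/allP/(_ f (mem_index_enum _)) => /=.
    by rewrite mulf_eq0 gt_eqF.
  have {}vconst := conn v vconst.
  have u0 e : deg e = 0 -> t * b e + deg e * x e = 0.
    by move=> d0; rewrite b0 // d0 mulr0 mul0r addr0.
  have usum : \sum_e (t * b e + deg e * x e) = 0.
    rewrite -[RHS]p0 /pairing mulr_sumr -big_split; apply: eq_bigr => e _ /=.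
    by rewrite (mulrC (x e)).
  case: (pickP (fun e => deg e != 0)) => [g dg|dall].
    transitivity ((\sum_e (t * b e + deg e * x e)) * v g); last first.
      by rewrite usum mul0r.
    rewrite mulr_suml; apply: eq_bigr => e _.
    have [/u0 ->|de] := eqVneq (deg e) 0; first by rewrite !mul0r.
    by rewrite (vconst e g).
  by apply: big1 => e _; rewrite u0 ?mul0r //; move/negbFE/eqP: (dall e).
pose bx := \sum_e b e * x e; pose bz := \sum_e b e * z e.
pose xx := \sum_e deg e * x e ^+ 2; pose zz := \sum_e deg e * z e ^+ 2.
pose xz := \sum_e deg e * (x e * z e).
pose lap y y' := \sum_e y e * (\sum_f N e f * y' f).
have lapxz : lap x z = t * bx + xx.
  rewrite /lap /bx mulr_sumr -big_split; apply: eq_bigr => e _ /=.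
  by rewrite zE; ring.
have lapzz : lap z z = t * bz + xz.
  rewrite /lap /bz mulr_sumr -big_split; apply: eq_bigr => e _ /=.
  by rewrite zE; ring.
have lapzx : lap z x = lap x z.
  transitivity (\sum_e \sum_f z e * (N e f * x f)).
    by apply: eq_bigr => e _; rewrite mulr_sumr.
  rewrite exchange_big; apply: eq_bigr => f _; rewrite mulr_sumr.
  apply: eq_bigr => e _; rewrite /N symA eq_sym; case: eqP => [->|_]; ring.
have quadE y : \sum_e \sum_f y e * A e f * y f =
    \sum_e deg e * y e ^+ 2 - lap y y.
  rewrite /lap -sumrB; apply: eq_bigr => e _.
  have -> : \sum_f y e * A e f * y f = y e * \sum_f A e f * y f.
    by rewrite mulr_sumr; apply: eq_bigr => f _; ring.
  by rewrite NE; ring.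
have sep : 0 <= lap x x - 2 * lap x z + lap z z.
  have := lap_ge0 (fun e => x e - z e).
  have -> // : \sum_e (x e - z e) * (\sum_f N e f * (x f - z f)) =
          lap x x - 2 * lap x z + lap z z.
  have -> : 2 * lap x z = lap x z + lap z x by rewrite lapzx; ring.
  rewrite opprD addrA /lap -!sumrB -big_split; apply: eq_bigr => e _ /=.
  have -> : \sum_f N e f * (x f - z f) =
    \sum_f N e f * x f - \sum_f N e f * z f.
    by rewrite -sumrB; apply: eq_bigr => f _; ring.
  by ring.
(* The equation for [z] turns t b + A z into D (z - x), so the bound becomes the sum of deg (z -
   x)^2. *)
have rhs : \sum_e (t * b e + \sum_f A e f * z f) ^+ 2 / deg e =
    zz - 2 * xz + xx.
  rewrite /zz /xz /xx mulr_sumr -sumrB -big_split; apply: eq_bigr => e _ /=.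
  have -> : t * b e + \sum_f A e f * z f = deg e * (z e - x e).
    have := zE e; rewrite NE => /eqP; rewrite subr_eq => /eqP.
    by rewrite mulrBr => ->; ring.
  have [->|de] := eqVneq (deg e) 0; first by rewrite invr0; ring.
  by field.
have := bnd t z; rewrite rhs /qform quadE -/zz -/bz lapzz => bz_le.
rewrite /qform quadE -/xx -/bx.
move: sep; rewrite lapxz lapzz => sep; lra.
Qed.
End Forms.

(** * Links and counts of independent sets *)

Section Links.
Variable E : finType.
Implicit Types (D : {set {set E}}) (S I : {set E}).

(** Empty, singleton and two-element [S] give the coefficients a, b and A of Q_m, so one counting
    identity treats all three. *)
Definition nind D j S := #|[set I in D | (#|I| == j) && (S \subset I)]|.

(** For a loop [e] of a matroid this family is empty, lacking even [set0], so sums over all [e] need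
    no side condition. *)
Definition link D e := [set I : {set E} | (e \notin I) && (e |: I \in D)].

Lemma nind_link D e j S :
  nind (link D e) j S = if e \in S then 0 else nind D j.+1 (e |: S).
Proof.
rewrite /nind; case: ifPn => eS.
  apply/eqP; rewrite cards_eq0; apply/eqP/setP => I; rewrite !inE.
  by apply/negP => /andP[/andP[eI _]] /andP[_ /subsetP/(_ _ eS)]; apply/negP.
rewrite -(card_in_imset (f := fun I => e |: I)) => [|I J]; last first.
  rewrite !inE => /andP[/andP[eI _] _] /andP[/andP[eJ _] _] IJ.
  by rewrite -(setU1K eI) IJ setU1K.
congr #|pred_of_set _|; apply/setP => J; rewrite inE.
apply/imsetP/idP => [[I]|/and3P[JD /eqP cJ eSJ]].
  rewrite !inE => /and3P[/andP[eI eID] /eqP cI SI] ->.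
  by rewrite eID cardsU1 eI cI eqxx setUS.
have eJ : e \in J by apply: (subsetP eSJ); rewrite setU11.
exists (J :\ e); last by rewrite setD1K.
rewrite !inE eqxx setD1K // JD /= subsetD1 eS andbT.
have := cardsD1 e J; rewrite eJ cJ add1n => -[<-]; rewrite eqxx /=.
by apply: subset_trans eSJ; rewrite subsetUr.
Qed.

(** Double count of the pairs (I, e) with [I] counted by [nind D j.+1 S] and [e] in [I :\: S]. *)
Lemma sum_nind_link D j S :
  \sum_e nind (link D e) j S = (j.+1 - #|S|) * nind D j.+1 S.
Proof.
under eq_bigr do rewrite nind_link.
transitivity (\sum_(I in [set I in D | (#|I| == j.+1) && (S \subset I)])
   \sum_(e in I :\: S) 1); last first.
  rewrite /nind mulnC -sum_nat_const; apply: eq_bigr => I.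
  rewrite inE => /and3P[_ /eqP cI SI].
  by rewrite sum1_card cardsDS ?cI.
under [RHS]eq_bigr do rewrite big_mkcond.
rewrite exchange_big /=; apply: eq_bigr => e _.
rewrite -big_mkcondr /nind; case: ifPn => eS.
  by rewrite big_pred0 // => I; rewrite !inE eS andbF.
rewrite -sum1_card; apply: eq_bigl => I; rewrite !inE eS subUset sub1set /=.
by rewrite -!andbA; do !bool_congr.
Qed.

Lemma link_matroid D e :
  is_matroid_complex D -> [set e] \in D -> is_matroid_complex (link D e).
Proof.
move=> [D0 Dsub Daug] De; split.
- by rewrite inE in_set0 setU0.
- move=> A B; rewrite !inE => /andP[eB eBD] AB; apply/andP; split.
    by apply: contra eB; apply/subsetP.
  by apply: Dsub eBD _; rewrite setUS.
- move=> A B; rewrite !inE => /andP[eA eAD] /andP[eB eBD] cAB.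
  have [|f] := Daug _ _ eAD eBD; first by rewrite !cardsU1 eA eB ltnS.
  rewrite !inE negb_or -andbA => /and3P[fe fA /orP[|fB]].
    by rewrite (negPf fe).
  rewrite setUCA => fD; exists f; rewrite !inE ?fA //.
  by rewrite fD negb_or eq_sym fe eA.
Qed.

Lemma extend_indep D A B j : is_matroid_complex D ->
  A \in D -> B \in D -> #|A| <= j <= #|B| ->
  exists2 I, I \in D & (A \subset I) && (#|I| == j).
Proof.
move=> [_ _ Daug] AD BD /andP[Aj jB].
move: {2}(j - #|A|) (erefl (j - #|A|)) => n; elim: n A AD Aj => [|n IHn] A AD Aj nE.
  by exists A => //; rewrite subxx eqn_leq Aj -subn_eq0 nE.
have [|e] := Daug A B AD BD; first by lia.
rewrite inE => /andP[eA _] eAD.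
have [||I ID /andP[eAI cI]] := IHn _ eAD; rewrite ?cardsU1 ?eA; try lia.
by exists I => //; rewrite cI (subset_trans _ eAI) ?subsetUr.
Qed.

Lemma nind_gt0 D A B j : is_matroid_complex D ->
  A \in D -> B \in D -> #|A| <= j <= #|B| -> 0 < nind D j A.
Proof.
move=> mD AD BD cAB; have [I ID AI] := extend_indep mD AD BD cAB.
by apply/card_gt0P; exists I; rewrite inE ID /= andbC.
Qed.

Lemma nind_eq0 D A j : is_matroid_complex D -> A \notin D -> nind D j A = 0.
Proof.
move=> [_ Dsub _] AD; apply/eqP; rewrite cards_eq0; apply/eqP/setP => I.
rewrite !inE; apply/negP => /and3P[ID _ AI].
by rewrite (Dsub _ _ ID AI) in AD.
Qed.

Lemma nind_card D (A : {set E}) : nind D #|A| A = (A \in D).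
Proof.
rewrite /nind; case: (boolP (A \in D)) => AD.
  rewrite (_ : [set _ in D | _] = [set A]) ?cards1 //; apply/setP => I.
  rewrite !inE; apply/and3P/eqP => [[_ /eqP cI AI]|->]; last by [].
  by apply/esym/eqP; rewrite eqEcard AI cI leqnn.
apply/eqP; rewrite cards_eq0; apply/eqP/setP => I; rewrite !inE.
apply/negP => /and3P[ID /eqP cI AI].
have : A == I by rewrite eqEcard AI cI leqnn.
by move/eqP => AE; rewrite AE ID in AD.
Qed.

(** Exchange of [[set f]] against [[set e; g]]. Read contrapositively, parallelism is transitive. *)
Lemma set2_trans D e f g : is_matroid_complex D -> [set f] \in D ->
  e != g -> [set e; g] \in D -> [set e; f] \in D \/ [set f; g] \in D.
Proof.
move=> [_ _ Daug] fD eg egD.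
have [|h] := Daug _ _ fD egD; first by rewrite cards1 cards2 eg.
rewrite !inE => /andP[_ /orP[]/eqP->]; first by left.
by rewrite setUC; right.
Qed.
End Links.

(** * The form Q_m of a matroid and its recursion over links *)

Section IndependenceForm.
Local Open Scope ring_scope.
Variable E : finType.
Implicit Types (D : {set {set E}}) (m : nat) (e f g : E).

Definition vertex_coef D m e : rat := (nind D m.+1 [set e])%:R.

(** The diagonal is zeroed explicitly: [[set e; e]] is a singleton, whose count would otherwise
    appear there. *)
Definition edge_coef D m e f : rat :=
  if e == f then 0 else (nind D m.+2 [set e; f])%:R.

Definition indep_form D m (t : rat) (x : E -> rat) : rat :=
  qform (nind D m set0)%:R (vertex_coef D m) (edge_coef D m) t x.

Lemma edge_coefC D m e f : edge_coef D m e f = edge_coef D m f e.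
Proof. by rewrite /edge_coef eq_sym setUC. Qed.

Lemma edge_coef_ge0 D m e f : 0 <= edge_coef D m e f.
Proof. by rewrite /edge_coef; case: eqP. Qed.

Lemma edge_coef_link D m e f :
  edge_coef D m.+1 e f = vertex_coef (link D e) m.+1 f.
Proof.
by rewrite /edge_coef /vertex_coef nind_link in_set1; case: (e == f).
Qed.

Lemma nind_set1 D m e : vertex_coef D m e = (nind (link D e) m set0)%:R.
Proof. by rewrite nind_link in_set0 setU0. Qed.

Lemma sum_vertex_coef D m :
  \sum_e vertex_coef D m e = m.+1%:R * (nind D m.+1 set0)%:R.
Proof.
under eq_bigr do rewrite nind_set1.
by rewrite -natr_sum sum_nind_link cards0 subn0 natrM.
Qed.

Lemma sum_edge_coef D m e :
  \sum_f edge_coef D m e f = m.+1%:R * vertex_coef D m.+1 e.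
Proof.
transitivity (\sum_f (nind (link D f) m.+1 [set e])%:R : rat).
  apply: eq_bigr => f _; rewrite nind_link in_set1 edge_coefC /edge_coef.
  by case: eqP.
by rewrite -natr_sum sum_nind_link cards1 subn1 natrM.
Qed.

Lemma sum_sum_edge_coef D m : \sum_e \sum_f edge_coef D m e f =
  m.+1%:R * (m.+2%:R * (nind D m.+2 set0)%:R).
Proof.
under eq_bigr do rewrite sum_edge_coef.
by rewrite -mulr_sumr sum_vertex_coef.
Qed.

Lemma sum_sum_edge_coef_gt0 D m : (0 < nind D m.+2 set0)%N ->
  0 < \sum_e \sum_f edge_coef D m e f.
Proof. by move=> D0; rewrite sum_sum_edge_coef !mulr_gt0 ?ltr0n. Qed.

(** A coefficient of a link form indexed by [S] of size k counts sets of size m+k, so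
    [sum_nind_link] yields the same factor (m+1+k) - k = m+1 for k = 0, 1, 2. *)
Lemma sum_indep_form_link D m t x :
  \sum_e indep_form (link D e) m t x = m.+1%:R * indep_form D m.+1 t x.
Proof.
rewrite /indep_form /qform !big_split /= !mulrDr; congr (_ + _ + _).
- by rewrite -mulr_suml -natr_sum sum_nind_link cards0 subn0 natrM -mulrA.
- rewrite -mulr_sumr exchange_big mulrCA; congr (_ * _); rewrite mulr_sumr.
  apply: eq_bigr => f _; rewrite -mulr_suml /vertex_coef -natr_sum.
  by rewrite sum_nind_link cards1 subn1 natrM mulrA.
- rewrite exchange_big mulr_sumr; apply: eq_bigr => f _.
  rewrite exchange_big mulr_sumr; apply: eq_bigr => g _.
  rewrite -mulr_suml -mulr_sumr /edge_coef; have [_|fg] := eqVneq f g.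
    by rewrite big1 // !(mulr0, mul0r).
  by rewrite -natr_sum sum_nind_link cards2 fg subn2 natrM /=; ring.
Qed.

(** Source of the numerators in [hyperbolic_step]: row [e] of [edge_coef] is [vertex_coef] of the
    link, so pairing with w there reads off coordinate [e] of t b + A x. *)
Lemma pairing_link D m e t x :
  pairing (vertex_coef (link D e) m) (edge_coef (link D e) m) t x =
  m.+1%:R * (t * vertex_coef D m.+1 e + \sum_f edge_coef D m.+1 e f * x f).
Proof.
rewrite /pairing sum_vertex_coef -nind_set1 mulrDr mulrCA; congr (_ + _).
rewrite mulr_sumr; apply: eq_bigr => f _.
by rewrite sum_edge_coef -edge_coef_link; ring.
Qed.

Lemma indep_form_link_loop D m e t x : is_matroid_complex D ->
  [set e] \notin D -> indep_form (link D e) m t x = 0.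
Proof.
move=> mD eD; have link0 j S : nind (link D e) j S = 0%N.
  rewrite nind_link; case: ifP => // _; apply: nind_eq0 => //.
  apply: contra eD => eSD; case: (mD) => _ Dsub _.
  by apply: Dsub eSD _; rewrite subsetUl.
rewrite /indep_form /qform link0 mul0r big1 => [|f _]; last first.
  by rewrite /vertex_coef link0 mul0r.
rewrite big1 => [|f _]; first by rewrite mulr0 !addr0.
by apply: big1 => g _; rewrite /edge_coef link0 if_same mulr0 mul0r.
Qed.

Lemma nind_set1_gt0 D j e : is_matroid_complex D -> (0 < nind D j.+1 set0)%N ->
  [set e] \in D -> (0 < nind D j.+1 [set e])%N.
Proof.
move=> mD /card_gt0P[B]; rewrite inE => /and3P[BD /eqP cB _] eD.
by apply: (nind_gt0 mD eD BD); rewrite cards1 cB leqnn.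
Qed.

Lemma edge_coef_gt0 D m e f : is_matroid_complex D ->
  (0 < nind D m.+2 set0)%N -> e != f -> [set e; f] \in D ->
  0 < edge_coef D m e f.
Proof.
move=> mD /card_gt0P[B]; rewrite inE => /and3P[BD /eqP cB _] ef efD.
rewrite /edge_coef (negPf ef) ltr0n; apply: (nind_gt0 mD efD BD).
by rewrite cards2 ef cB leqnn.
Qed.

(* The parallel classes are encoded as the fibres of [rho] on the non-loops. *)
Lemma indep_form0_le D t x : is_matroid_complex D ->
  indep_form D 0 t x <= (t + \sum_e vertex_coef D 0 e * x e) ^+ 2.
Proof.
move=> mD; have [D0 Dsub _] := mD.
pose par e f := (e == f) || ([set e; f] \notin D).
pose rho e := [set f | ([set f] \in D) && par e f].
pose cls (S : {set E}) := \sum_(e | ([set e] \in D) && (rho e == S)) x e.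
have bE e : vertex_coef D 0 e = ([set e] \in D)%:R.
  by rewrite /vertex_coef -nind_card cards1.
(* Transitivity of parallelism: non-loops share a fibre exactly when parallel, so a nonempty [cls]
   sums over one parallel class. *)
have parE e f : [set e] \in D -> [set f] \in D -> (rho f == rho e) = par e f.
  move=> eD fD; apply/eqP/idP => [/setP/(_ f)|ef].
    by rewrite !inE fD {1}/par eqxx /= => <-.
  have [<- //|/negPf nef] := eqVneq e f.
  move: ef; rewrite /par nef /= => efD.
  apply/setP => g; rewrite !inE; case gD: ([set g] \in D) => //=.
  rewrite /par; have [<-|fg] := eqVneq f g; first by rewrite nef efD.
  have [<-|eg] := eqVneq e g; first by rewrite setUC efD.
  apply/idP/idP => /=; apply: contra => gD'.
    by have [|//] := set2_trans mD fD eg gD'; rewrite (negPf efD).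
  by have [|//] := set2_trans mD eD fg gD'; rewrite setUC (negPf efD).
have nind0 : nind D 0 set0 = 1%N by have := nind_card D set0; rewrite cards0 D0.
(* For m = 0, b_e b_f - A_ef is 1 on parallel pairs of non-loops (including e = f) and 0 on all
   other pairs. *)
have clsE : \sum_S cls S ^+ 2 = \sum_e \sum_f
    x e * (vertex_coef D 0 e * vertex_coef D 0 f - edge_coef D 0 e f) * x f.
  transitivity (\sum_S \sum_e \sum_f
     ((([set e] \in D) && (rho e == S)) &&
      (([set f] \in D) && (rho f == S)))%:R * (x e * x f)).
    apply: eq_bigr => S _; rewrite expr2 /cls big_distrlr /= big_mkcond.
    apply: eq_bigr => e _; case: ifP => _ /=; last first.
      by rewrite big1 // => f _; rewrite mul0r.
    rewrite big_mkcond; apply: eq_bigr => f _.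
    by case: ifP; rewrite ?mul1r ?mul0r.
  rewrite exchange_big; apply: eq_bigr => e _.
  rewrite exchange_big; apply: eq_bigr => f _.
  rewrite -mulr_suml (bigD1 (rho e)) //= big1 ?addr0 => [|S /negPf nS]; last first.
    by rewrite eq_sym nS andbF.
  rewrite eqxx andbT !bE mulrAC mulrC; congr (_ * _).
  rewrite /edge_coef; case eD: ([set e] \in D); last first.
    rewrite mul0r nind_eq0 ?if_same ?subr0 //; apply: contraFN eD => efD.
    by apply: Dsub efD _; rewrite subsetUl.
  case fD: ([set f] \in D); last first.
    rewrite mulr0 nind_eq0 ?if_same ?subr0 //; apply: contraFN fD => efD.
    by apply: Dsub efD _; rewrite subsetUr.
  rewrite /= parE // mul1r /par; have [_|ef] := eqVneq e f; first by rewrite subr0.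
  have -> : 2%N = #|[set e; f]| by rewrite cards2 ef.
  by rewrite nind_card; case: (_ \in D).
rewrite -subr_ge0; have -> : (t + \sum_e vertex_coef D 0 e * x e) ^+ 2 -
    indep_form D 0 t x = \sum_S cls S ^+ 2; last first.
  by rewrite sumr_ge0 // => S _; rewrite sqr_ge0.
have -> : \sum_S cls S ^+ 2 = (\sum_e vertex_coef D 0 e * x e) ^+ 2
    - \sum_e \sum_f x e * edge_coef D 0 e f * x f.
  rewrite clsE expr2 big_distrlr /= -sumrB; apply: eq_bigr => e _.
  by rewrite -sumrB; apply: eq_bigr => f _; ring.
by rewrite /indep_form /qform nind0; ring.
Qed.

(** * Induction for hyperbolicity, and Mason's inequality *)

Lemma indep_form_hyperbolic D m :
  is_matroid_complex D -> (0 < nind D m.+2 set0)%N ->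
  hyperbolic (nind D m set0)%:R (vertex_coef D m) (edge_coef D m).
Proof.
elim: m D => [|m IHm] D mD D0.
  apply: (@hyperbolic_of_rank_one_bound _ _ _ _ _
           (fun t x => t + \sum_e vertex_coef D 0 e * x e)).
  - exact: edge_coefC.
  - exact: sum_sum_edge_coef_gt0.
  - move=> t x c d; rewrite mulrDr add0r -addrA; congr (_ + _).
    by rewrite !mulr_sumr -big_split; apply: eq_bigr => e _ /=; ring.
  - by move=> t x; exact: indep_form0_le.
have nonloop e : \sum_f edge_coef D m.+1 e f != 0 -> [set e] \in D.
  rewrite sum_edge_coef; apply: contraNT => eD.
  by rewrite /vertex_coef nind_eq0 ?mulr0.
have deg_gt0 e : [set e] \in D -> 0 < \sum_f edge_coef D m.+1 e f.
  by move=> eD; rewrite sum_edge_coef mulr_gt0 ?ltr0n // nind_set1_gt0.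
apply: hyperbolic_step.
- exact: edge_coefC.
- exact: edge_coef_ge0.
- move=> e deg0; rewrite /vertex_coef nind_eq0 //.
  by apply/negP => /deg_gt0; rewrite deg0 ltxx.
- move=> x xE e f /nonloop eD /nonloop fD.
  have adj g h : g != h -> [set g; h] \in D -> x g = x h.
    by move=> gh ghD; apply: xE; exact: edge_coef_gt0.
  have [-> //|ef] := eqVneq e f.
  have [efD|efD] := boolP ([set e; f] \in D); first exact: adj.
  (* Parallel [e] and [f] have a common neighbour: exchange with a large independent set gives [g]
     adjacent to [e], and [set2_trans] makes it adjacent to [f]. *)
  have [_ _ Daug] := mD.
  have /card_gt0P[B] := D0; rewrite inE => /and3P[BD /eqP cB _].
  have [|g] := Daug _ _ eD BD; first by rewrite cards1 cB.
  rewrite !inE => /andP[ge _]; rewrite setUC => egD; rewrite eq_sym in ge.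
  have [|fgD] := set2_trans mD fD ge egD; first by rewrite (negPf efD).
  rewrite (adj e g) // (adj f g) //.
  by apply: contraNneq efD => ->.
(* The bound is proved summand by summand: in the link of a non-loop [e], Q(w) is (m+1) deg e and
   the pairing is (m+1) s, so Cauchy-Schwarz bounds the link form by (m+1) s^2 / deg e. *)
- move=> t x; rewrite -/(indep_form D m.+1 t x).
  have m0 : 0 < m.+1%:R :> rat by rewrite ltr0n.
  rewrite -(ler_pM2l m0) -sum_indep_form_link mulr_sumr; apply: ler_sum => e _.
  set s := _ + _; have [eD|eD] := boolP ([set e] \in D); last first.
    rewrite indep_form_link_loop // mulr_ge0 ?(ltW m0) // divr_ge0 ?sqr_ge0 //.
    by rewrite sumr_ge0 // => f _; exact: edge_coef_ge0.
  have d0 := deg_gt0 e eD; rewrite mulrA ler_pdivlMr // -(ler_pM2l m0).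
  have link0 : (0 < nind (link D e) m.+2 set0)%N.
    by rewrite nind_link in_set0 setU0 nind_set1_gt0.
  have := hyperbolic_cauchy_schwarz t x (@edge_coefC (link D e) m)
    (sum_sum_edge_coef_gt0 link0) (IHm _ (link_matroid mD eD) link0).
  rewrite -/(indep_form _ _ _ _) pairing_link -/s sum_sum_edge_coef -nind_set1.
  rewrite -sum_edge_coef; set q := indep_form _ _ _ _; set d := \sum_f _.
  by rewrite exprMn expr2 mulrCA !mulrA.
Qed.

Lemma fvecE D i : fvec D i = nind D i set0.
Proof. by apply: eq_card => I; rewrite !inE sub0set andbT. Qed.

Lemma mason_strong_log_concavity D m :
  is_matroid_complex D -> (0 < nind D m.+2 set0)%N ->
  (m.+2 * (fvec D m * fvec D m.+2) <= m.+1 * fvec D m.+1 ^ 2)%N.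
Proof.
move=> mD D0; rewrite !fvecE.
have := hyperbolic_cauchy_schwarz 1 (fun=> 0) (@edge_coefC D m)
    (sum_sum_edge_coef_gt0 D0) (indep_form_hyperbolic mD D0).
have -> : pairing (vertex_coef D m) (edge_coef D m) 1 (fun=> 0) =
    \sum_e vertex_coef D m e.
  by rewrite /pairing mul1r [X in _ + X]big1 ?addr0 // => e _; rewrite mul0r.
rewrite sum_sum_edge_coef sum_vertex_coef /qform expr1n mulr1.
rewrite big1 ?mulr0 ?addr0 => [|e _]; last by rewrite mulr0.
rewrite big1 ?addr0 => [|e _]; last by apply: big1 => f _; rewrite mulr0.
rewrite -!natrM -natrX ler_nat => le.
(* At (1, 0) Cauchy-Schwarz reads f_m (m+1) (m+2) f_(m+2) <= ((m+1) f_(m+1))^2; one factor m+1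
   cancels. *)
rewrite -(leq_pmul2l (ltn0Sn m)); apply: leq_trans (leq_trans le _); lia.
Qed.
End IndependenceForm.

Theorem theorem1 (E : finType) (D : {set {set E}}) :
  is_matroid_complex D -> realizable D ->
  forall i : nat, 1 <= i -> i + 1 <= mrank D ->
    fvec D (i - 1) * fvec D (i + 1) < fvec D i ^ 2.
Proof.
move=> mD _ [//|m] _; rewrite addn1 subn1 /= => rk.
have [D0 _ _] := mD.
have pos j : j <= mrank D -> 0 < nind D j set0.
  have Dn0 : 0 < #|D| by apply/card_gt0P; exists set0.
  rewrite /mrank; have [B BD ->] := eq_bigmax_cond (fun A : {set E} => #|A|) Dn0.
  by move=> jB; apply: (nind_gt0 mD D0 BD); rewrite cards0.
(* Strictness: f_(m+1) > 0 gives (m+1) f_(m+1)^2 < (m+2) f_(m+1)^2. *)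
have := mason_strong_log_concavity mD (pos _ rk).
have := pos m.+1 (ltnW rk); rewrite -fvecE; nia.
Qed.
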